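(* Let $f(\cdot,\xi)$ be $(\mathcal L_0,\mathcal L_1)$-smooth and convex for almost every $\xi\sim\mathcal D$, and let the stochastic gradient oracle be unbiased and satisfy the strong growth condition with constant $\rho\ge1$, i.e. $\mathbb{E}_\xi[\|\nabla f(x,\xi)\|^2]\le\rho\|\nabla f(x)\|^2$ for all $x\in\mathbb{R}^d$. Then NSGD with $\lambda>0$, constant step size $0<\eta\le\frac{\lambda}{\mathcal L_0+\sqrt\rho\,\mathcal L_1\lambda}$ and batch size $B\ge64(\rho-1)$ yields, after $N$ iterations, $$\mathbb{E}[f(x^N)]-f^*\le\left(1-\frac{\eta}{4R_0}\right)^NF_0+6\lambda R_0,$$ where $F_0=f(x^0)-f^*$ and $R_0=\|x^0-x^*\|$.
   Context: Setting: $f(x)=\mathbb{E}_{\xi\sim\mathcal D}[f(x,\xi)]$ on $\mathbb{R}^d$, with $f$ and $f(\cdot,\xi)$ differentiable, $f^*=\min_{x}f(x)$, $x^*\in\arg\min f$, and $\|\cdot\|$ the Euclidean norm. The oracle returns stochastic gradients $\nabla f(x,\xi)$, $\xi\sim\mathcal D$. ''$f(\cdot,\xi)$ is $(\mathcal L_0,\mathcal L_1)$-smooth and convex'' ($\mathcal L_0,\mathcal L_1\ge0$) means: for all $x,y,z\in\mathbb{R}^d$ with $\|y-z\|\le1/\mathcal L_1$ (with $1/\mathcal L_1=+\infty$ if $\mathcal L_1=0$), $$f(x,\xi)+\langle\nabla f(x,\xi),y-x\rangle\le f(y,\xi)\le f(z,\xi)+\langle\nabla f(z,\xi),y-z\rangle+\frac{\mathcal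 L_0+\mathcal L_1\|\nabla f(z,\xi)\|}{2}\|y-z\|^2.$$ Unbiasedness: $\mathbb{E}_\xi[\nabla f(x,\xi)]=\nabla f(x)$ for all $x$. NSGD: given $x^0\in\mathbb{R}^d$, integer batch size $B\ge1$, $\eta>0$, $\lambda>0$; at iteration $k$ draw fresh i.i.d. samples $\xi_1^k,\dots,\xi_B^k\sim\mathcal D$ (independent of the past), form $g^k=\frac1B\sum_{i=1}^B\nabla f(x^k,\xi_i^k)$, and set $x^{k+1}=x^k-\eta\,\frac{g^k}{\|g^k\|+\lambda}$.
   Formalization: Adds the assumption 1 − η/(4R_0) ≥ 0; without it the claim fails, e.g. d=1, f(x,ξ)=x²/2, L_0=1, L_1=0, ρ=1, B=1, λ=η=10, x^0=0.1, N=3, where the right side is −63.12. If R_0=0, η/(4R_0) is read as 0. *)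

(* Defs.v *)
From HB Require Import structures.
From mathcomp Require Export all_boot all_order all_algebra.
From mathcomp Require Export all_classical all_reals all_analysis.

Set Implicit Arguments.
Unset Strict Implicit.
Unset Printing Implicit Defensive.

Export Order.TTheory GRing.Theory Num.Theory.
Export numFieldNormedType.Exports.

Local Open Scope classical_set_scope.
Local Open Scope ring_scope.

(* The library norm `|u| on row vectors is the sup norm, hence these two. *)
Definition dot (R : realType) (d : nat) (u v : 'rV[R]_d) : R :=
  \sum_(i < d) u 0 i * v 0 i.

Definition enorm (R : realType) (d : nat) (u : 'rV[R]_d) : R :=
  Num.sqrt (dot u u).

(* Only used for differentiable h. *)
Definition grad (R : realType) (d : nat) (h : 'rV[R]_d -> R) (x : 'rV[R]_d) :
    'rV[R]_d :=
  \row_(i < d) 'D_(delta_mx 0 i) h x.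

(* The inverse is taken in \bar R, where 0^-1 = +oo: for L1 = 0 the upper bound
   is required for all y and z. *)
Definition smooth_convex (R : realType) (d : nat) (L0 L1 : R)
    (h : 'rV[R]_d -> R) : Prop :=
  forall x y z : 'rV[R]_d, ((enorm (y - z))%:E <= (L1%:E)^-1)%E ->
    h x + dot (grad h x) (y - x) <= h y /\
    h y <= h z + dot (grad h z) (y - z)
           + (L0 + L1 * enorm (grad h z)) / 2 * enorm (y - z) ^+ 2.

Definition mutually_independent (R : realType) (dO dX : measure_display)
    (Omega : measurableType dO) (Xi : measurableType dX)
    (P : probability Omega R) (I : eqType) (X : I -> {RV P >-> Xi}) : Prop :=
  forall (s : seq I) (A : I -> set Xi), uniq s ->
    (forall i, i \in s -> measurable (A i)) ->
    P (\bigcap_(i in [set` s]) (X i @^-1` A i)) =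
    (\prod_(i <- s) P (X i @^-1` A i))%E.

Definition iid (R : realType) (dO dX : measure_display)
    (Omega : measurableType dO) (Xi : measurableType dX)
    (P : probability Omega R) (D : probability Xi R)
    (I : eqType) (X : I -> {RV P >-> Xi}) : Prop :=
  mutually_independent X /\
  forall (i : I) (A : set Xi), measurable A -> distribution P (X i) A = D A.

(* [xi k i] is the [i]-th sample of the batch drawn at iteration [k]. *)
Fixpoint nsgd (R : realType) (d : nat) (Xi : Type)
    (f : 'rV[R]_d -> Xi -> R) (B : nat) (eta lambda : R) (x0 : 'rV[R]_d)
    (xi : nat -> 'I_B -> Xi) (k : nat) : 'rV[R]_d :=
  if k is k'.+1 then
    let x := nsgd f eta lambda x0 xi k' in
    let g := B%:R^-1 *: \sum_(i < B) grad (f^~ (xi k' i)) x in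
    x - (eta / (enorm g + lambda)) *: g
  else x0.

(* Main.v *)
From HB Require Import structures.
From mathcomp Require Import ring lra measurable_realfun.
Require Import Defs.

Set Implicit Arguments.
Unset Strict Implicit.
Unset Printing Implicit Defensive.

Local Open Scope classical_set_scope.
Local Open Scope ring_scope.

(** Every quantity is controlled by the gap [F x - F xstar], the gradient norm
    [|grad F x|] and the error [g - grad F x] of the batch gradient [g].

    Along a normalized step, smoothness of [F] gives, for every outcome,
    [F x' + eta / 2 * |grad F x| <=
     F x + 3 / 2 * eta * lambda + 2 * eta * |g - grad F x|]
    ([normalized_step_descent], [step_descent]).  Here [F] is smooth with
    constants [L0] and [sqrt rho * L1], because averaging the inequality of the
    samples only asks for [E |grad f| <= sqrt rho * |grad F|]
    ([objective_smooth]), and these are the constants in the bound on [eta].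
    By strong growth the batch gradient has variance at most
    [(rho - 1) / B * |grad F x| ^ 2 <= (|grad F x| / 8) ^ 2], so that its mean
    error is at most [|grad F x| / 8] ([batch_error_le], [step_error_le]).
    Half of the gain is then left:
    [E F x' <= E F x - eta / 4 * E |grad F x| + 3 / 2 * eta * lambda]
    ([expected_step]).

    Convexity turns the gradient norm into the gap,
    [F x - F xstar <= |x - xstar| * |grad F x|], provided that the distance to
    [xstar] does not grow.  It does not, almost surely: strong growth at
    [xstar] forces almost every sample gradient to vanish there
    ([interpolation]), so that almost every sample is minimized by [xstar], and
    a smooth convex function satisfies
    [<grad h x, x - xstar> >= eta / 2 * |grad h x| ^ 2 / (lambda + |grad h x|)]
    ([suboptimality_ge_grad]).  The right-hand side is a convex increasing
    function of the norm, so that the inequality passes to batch means, and it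
    is exactly what a normalized step needs in order not to move away from
    [xstar] ([normalized_step_contracts], [iterate_dist_le]).  The resulting
    recursion is solved by [descent_recursion].

    The probabilistic part consists of two facts.  The oracle gradients are
    jointly measurable in the point and the sample, as limits of difference
    quotients of functions continuous in the point ([measurable_caratheodory],
    [measurable_grad]).  The batch of step [k] is independent of [x k], a
    function of the earlier batches: with [Omega] carrying the sigma-algebra of
    the earlier batches on one side and that of the current one on the other,
    the diagonal map has the product law, and Tonelli's theorem lets [x k] be
    held fixed while the batch is averaged ([freezing]). *)

(** * Euclidean geometry of row vectors *)

Section Euclidean.
Context {R : realType} {d : nat}.
Implicit Types (u v w : 'rV[R]_d) (a : R).

Lemma dotC u v : dot u v = dot v u.
Proof. by apply: eq_bigr => i _; rewrite mulrC. Qed.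

Lemma dotDl u v w : dot (u + v) w = dot u w + dot v w.
Proof. by rewrite -big_split; apply: eq_bigr => i _ /=; rewrite mxE mulrDl. Qed.

Lemma dotZl a u v : dot (a *: u) v = a * dot u v.
Proof. by rewrite mulr_sumr; apply: eq_bigr => i _; rewrite mxE mulrA. Qed.

Lemma dotNl u v : dot (- u) v = - dot u v.
Proof. by rewrite -scaleN1r dotZl mulN1r. Qed.

Lemma dotDr u v w : dot w (u + v) = dot w u + dot w v.
Proof. by rewrite dotC dotDl !(dotC w). Qed.

Lemma dotZr a u v : dot u (a *: v) = a * dot u v.
Proof. by rewrite dotC dotZl dotC. Qed.

Lemma dotNr u v : dot u (- v) = - dot u v.
Proof. by rewrite dotC dotNl dotC. Qed.

Lemma dot0l v : dot 0 v = 0.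
Proof. by rewrite -(scale0r v) dotZl mul0r. Qed.

Lemma dot_suml (I : Type) (r : seq I) (G : I -> 'rV[R]_d) v :
  dot (\sum_(i <- r) G i) v = \sum_(i <- r) dot (G i) v.
Proof. by elim/big_rec2: _ => [|i _ w _ <-]; rewrite ?dot0l ?dotDl. Qed.

Definition dotE := (dotDl, dotDr, dotNl, dotNr, dotZl, dotZr).

Lemma dot_ge0 u : 0 <= dot u u.
Proof. by apply: sumr_ge0 => i _; rewrite -expr2 sqr_ge0. Qed.

Lemma enorm_ge0 u : 0 <= enorm u.
Proof. exact: sqrtr_ge0. Qed.

Lemma sqr_enorm u : enorm u ^+ 2 = dot u u.
Proof. by rewrite sqr_sqrtr ?dot_ge0. Qed.

Lemma enorm_sum_sqr u : enorm u ^+ 2 = \sum_(i < d) u 0 i ^+ 2.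
Proof. by rewrite sqr_enorm; apply: eq_bigr => i _; rewrite expr2. Qed.

Lemma enorm0 : enorm (0 : 'rV[R]_d) = 0.
Proof. by rewrite /enorm dot0l sqrtr0. Qed.

Lemma enorm0_eq0 u : enorm u = 0 -> u = 0.
Proof.
move=> u0; have /eqP : \sum_(i < d) u 0 i ^+ 2 = 0.
  by rewrite -enorm_sum_sqr u0 expr0n.
rewrite psumr_eq0 => [/allP uE|i _]; last exact: sqr_ge0.
apply/rowP => i; rewrite mxE; apply/eqP; rewrite -sqrf_eq0.
exact: uE (mem_index_enum i).
Qed.

Lemma enormN u : enorm (- u) = enorm u.
Proof. by rewrite /enorm !dotE opprK. Qed.

Lemma enormZ a u : enorm (a *: u) = `|a| * enorm u.
Proof.
by rewrite /enorm !dotE mulrA -expr2 sqrtrM ?sqr_ge0// sqrtr_sqr.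
Qed.

(** Expanding the square of [ |v| u - |u| v ] gives Cauchy-Schwarz. *)
Lemma dot_le_enorm u v : dot u v <= enorm u * enorm v.
Proof.
have [u0|u0] := eqVneq (enorm u) 0.
  by rewrite (enorm0_eq0 u0) dot0l enorm0 mul0r.
have [v0|v0] := eqVneq (enorm v) 0.
  by rewrite (enorm0_eq0 v0) dotC dot0l enorm0 mulr0.
have u_gt0 : 0 < enorm u by rewrite lt0r u0 enorm_ge0.
have v_gt0 : 0 < enorm v by rewrite lt0r v0 enorm_ge0.
have := dot_ge0 (enorm v *: u - enorm u *: v).
rewrite !dotE -!sqr_enorm (dotC v u) => h.
by rewrite -(ler_pM2l (mulr_gt0 u_gt0 v_gt0)); nra.
Qed.

Lemma enormD u v : enorm (u + v) <= enorm u + enorm v.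
Proof.
rewrite -(@ler_pXn2r _ 2)// ?nnegrE ?addr_ge0 ?enorm_ge0//.
rewrite sqrrD !sqr_enorm !dotE (dotC v u).
by have := dot_le_enorm u v; lra.
Qed.

Lemma enorm_sum (I : Type) (r : seq I) (G : I -> 'rV[R]_d) :
  enorm (\sum_(i <- r) G i) <= \sum_(i <- r) enorm (G i).
Proof.
elim/big_rec2: _ => [|i a w _ h]; first by rewrite enorm0.
by apply: le_trans (enormD _ _) _; rewrite lerD2l.
Qed.

Lemma coord_le_enorm u i : `|u 0 i| <= enorm u.
Proof.
rewrite -(@ler_pXn2r _ 2)// ?nnegrE ?enorm_ge0// enorm_sum_sqr.
rewrite real_normK ?num_real//.
by rewrite (bigD1 i)//= lerDl sumr_ge0// => j _; exact: sqr_ge0.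
Qed.

End Euclidean.

(** * Smooth convex functions and normalized steps *)

(** The guarantee of a gradient step of size [eta / (lambda + |grad h z|)]:
    this size is admissible for the smoothness inequality, and small enough for
    the linear term to be twice the quadratic one.  No division by
    [L0 + L1 |grad h z|] occurs, so that the case [L0 = L1 = 0] is not
    special. *)
Lemma suboptimality_ge_grad (R : realType) (d : nat) (L0 L1 eta lambda : R)
    (h : 'rV[R]_d -> R) (m : R) (z : 'rV[R]_d) :
  0 < lambda -> 0 < eta -> eta * L0 <= lambda -> eta * L1 <= 1 ->
  (forall y, m <= h y) ->
  (forall y, enorm (y - z) <= eta ->
    h y <= h z + dot (grad h z) (y - z)
           + (L0 + L1 * enorm (grad h z)) / 2 * enorm (y - z) ^+ 2) ->
  eta / 2 * (enorm (grad h z) ^+ 2 / (lambda + enorm (grad h z))) <= h z - m.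
Proof.
move=> lam0 eta0 eL0 eL1 hm hsm.
set G := grad h z in hsm *; set g := enorm G in hsm *.
have g0 : 0 <= g by exact: enorm_ge0.
have lg0 : 0 < lambda + g by lra.
pose s := eta / (lambda + g).
have s0 : 0 < s by rewrite divr_gt0.
have sE : s * (lambda + g) = eta by rewrite /s; field; lra.
have yE : z - s *: G - z = - (s *: G) by rewrite addrAC subrr add0r.
have hs : h (z - s *: G) <=
          h z - s * g ^+ 2 + (L0 + L1 * g) / 2 * (s * g) ^+ 2.
  have := hsm (z - s *: G); rewrite yE enormN enormZ gtr0_norm//.
  by rewrite dotNr dotZr -sqr_enorm -/g; apply; rewrite -sE; nra.
have : (L0 + L1 * g) * s <= 1.
  rewrite /s mulrA ler_pdivrMr//; nra.
move=> hs1.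
have hs3 : (L0 + L1 * g) / 2 * (s * g) ^+ 2 <= s * g ^+ 2 / 2.
  have -> : (L0 + L1 * g) / 2 * (s * g) ^+ 2 =
            ((L0 + L1 * g) * s) * (s * g ^+ 2 / 2) by ring.
  by rewrite ler_piMl// divr_ge0// mulr_ge0 ?sqr_ge0// ltW.
have -> : eta / 2 * (g ^+ 2 / (lambda + g)) = s * g ^+ 2 / 2.
  by rewrite /s; field; lra.
by have := hm (z - s *: G); lra.
Qed.

(** Jensen's inequality for the increasing convex function
    [t ^ 2 / (lambda + t)], through its tangent at [t]. *)
Lemma sqr_div_jensen (R : realFieldType) (B : nat) (lambda t : R)
    (a : 'I_B -> R) :
  (0 < B)%N -> 0 < lambda -> 0 <= t -> (forall i, 0 <= a i) ->
  t <= B%:R^-1 * \sum_i a i ->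
  t ^+ 2 / (lambda + t) <= B%:R^-1 * \sum_i (a i ^+ 2 / (lambda + a i)).
Proof.
move=> B0 lam0 t0 a0 ta.
have BR0 : 0 < B%:R :> R by rewrite ltr0n.
have lt0 : 0 < lambda + t by lra.
pose c := t / (lambda + t).
have c0 : 0 <= c by rewrite divr_ge0// ltW.
have c1 : c <= 1 by rewrite ler_pdivrMr//; lra.
have tangent i : (2 * c - c ^+ 2) * a i - c ^+ 2 * lambda
                 <= a i ^+ 2 / (lambda + a i).
  have la0 : 0 < lambda + a i by have := a0 i; lra.
  rewrite ler_pdivlMr//.
  have := sqr_ge0 (a i - c * (lambda + a i)); nra.
apply: (@le_trans _ _
  ((2 * c - c ^+ 2) * (B%:R^-1 * \sum_i a i) - c ^+ 2 * lambda)).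
  apply: (@le_trans _ _ ((2 * c - c ^+ 2) * t - c ^+ 2 * lambda)); last first.
    by rewrite lerD2r ler_wpM2l//; nra.
  by rewrite le_eqVlt; apply/orP; left; apply/eqP; rewrite /c; field; lra.
have -> : (2 * c - c ^+ 2) * (B%:R^-1 * \sum_i a i) - c ^+ 2 * lambda =
  B%:R^-1 * \sum_i ((2 * c - c ^+ 2) * a i - c ^+ 2 * lambda).
  rewrite sumrB -mulr_sumr sumr_const card_ord -mulr_natr.
  by field; rewrite gt_eqF.
by rewrite ler_wpM2l ?invr_ge0 ?ler0n// ler_sum.
Qed.

(** Correlation with the direction to the minimizer dominates the squared step:
    a normalized step does not move away from [y]. *)
Lemma normalized_step_contracts (R : realType) (d : nat) (eta lambda : R)
    (x y g : 'rV[R]_d) :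
  0 < lambda -> 0 < eta ->
  eta / 2 * (enorm g ^+ 2 / (lambda + enorm g)) <= dot g (x - y) ->
  enorm (x - (eta / (enorm g + lambda)) *: g - y) <= enorm (x - y).
Proof.
move=> lam0 eta0; set n := enorm g => hg.
have n0 : 0 <= n by exact: enorm_ge0.
have ln0 : 0 < lambda + n by lra.
pose s := eta / (n + lambda).
have s0 : 0 < s by rewrite divr_gt0//; lra.
rewrite -(@ler_pXn2r _ 2)// ?nnegrE ?enorm_ge0//.
rewrite -/s (addrAC x); move: (x - y) hg => w hg.
rewrite sqr_enorm !dotE -!sqr_enorm (dotC w g) -/n.
have : s * (eta / 2 * (n ^+ 2 / (lambda + n))) <= s * dot g w.
  by rewrite ler_pM2l.
have -> : s * (eta / 2 * (n ^+ 2 / (lambda + n))) = s ^+ 2 * n ^+ 2 / 2.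
  by rewrite /s; field; lra.
nra.
Qed.

(** The descent of one step with an inexact gradient [g] of [G].  The constants
    come from [<G, g> >= |g| (|G| - 2 |g - G|)] and from
    [lambda |G| / (|g| + lambda) <= lambda + |g - G|]. *)
Lemma normalized_step_descent (R : realType) (d : nat) (L0 L1 eta lambda : R)
    (G g v : 'rV[R]_d) :
  0 <= L0 -> 0 <= L1 -> 0 < lambda -> 0 < eta ->
  eta * (L0 + L1 * lambda) <= lambda ->
  v = - ((eta / (enorm g + lambda)) *: g) ->
  dot G v + (L0 + L1 * enorm G) / 2 * enorm v ^+ 2 <=
  - (eta / 2 * enorm G) + 3 / 2 * eta * lambda + 2 * eta * enorm (g - G).
Proof.
move=> L00 L10 lam0 eta0 eL ->.
rewrite enormN enormZ dotNr dotZr.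
set n := enorm g; set c := enorm G; set e := enorm (g - G).
have n0 : 0 <= n by exact: enorm_ge0.
have c0 : 0 <= c by exact: enorm_ge0.
have e0 : 0 <= e by exact: enorm_ge0.
have nl0 : 0 < n + lambda by lra.
pose s := (n + lambda)^-1.
have s0 : 0 < s by rewrite invr_gt0.
have sE : s * (n + lambda) = 1 by rewrite mulVf// gt_eqF.
have ncE : c <= n + e.
  have -> : c = enorm (g - (g - G)) by rewrite subKr.
  by apply: le_trans (enormD _ _) _; rewrite enormN.
have Gg : n * (c - 2 * e) <= dot G g.
  have -> : dot G g = n ^+ 2 - dot (g - G) g.
    by rewrite !dotE -sqr_enorm -/n; ring.
  by have := dot_le_enorm (g - G) g; rewrite -/e -/n; nra.
rewrite ger0_norm; last by rewrite divr_ge0// ltW.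
have -> : eta / (n + lambda) = eta * s by [].
pose u := s * n.
have u0 : 0 <= u by rewrite mulr_ge0// ltW.
have u1 : u <= 1 by rewrite /u; nra.
(* The step is at most [eta] long, and [eta * (L0 + L1 * c) <= lambda + c]. *)
have quad : (L0 + L1 * c) / 2 * (eta * s * n) ^+ 2 <= eta / 2 * (lambda + c).
  have -> : (L0 + L1 * c) / 2 * (eta * s * n) ^+ 2 =
            eta / 2 * (eta * (L0 + L1 * c)) * u ^+ 2 by rewrite /u; ring.
  have e1 : eta * (L0 + L1 * c) <= lambda + c.
    have L0l : 0 <= eta * L0 by rewrite mulr_ge0// ltW.
    have L1l : 0 <= eta * L1 * lambda by rewrite !mulr_ge0// ltW.
    have eL1 : eta * L1 <= 1.
      rewrite -(ler_pM2r lam0); nra.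
    have : eta * L1 * c <= c by rewrite ler_piMl.
    nra.
  have e2 : 0 <= eta * (L0 + L1 * c) by rewrite mulr_ge0 ?addr_ge0 ?mulr_ge0// ltW.
  have u2 : u ^+ 2 <= 1 by rewrite expr_le1.
  have : eta * (L0 + L1 * c) * u ^+ 2 <= lambda + c.
    by apply: le_trans e1; rewrite ler_piMr.
  by rewrite -(mulrA (eta / 2)) ler_pM2l// divr_gt0.
have lin : c - lambda - 2 * e <= s * dot G g.
  apply: (@le_trans _ _ (s * (n * (c - 2 * e)))); last by rewrite ler_pM2l.
  rewrite -(ler_pM2l nl0) mulrA (mulrC _ s) sE mul1r.
  nra.
have := ler_wpM2l (ltW eta0) lin; rewrite mulrA; lra.
Qed.

(** * Measurability along the iterates *)

Section Measurability.
Context {R : realType} {d : nat} {dT : measure_display} {T : measurableType dT}.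

Definition measurable_vec (X : T -> 'rV[R]_d) :=
  forall i, measurable_fun setT (fun t => X t 0 i).

Lemma measurable_enorm (X : T -> 'rV[R]_d) :
  measurable_vec X -> measurable_fun setT (fun t => enorm (X t)).
Proof.
move=> mX.
have msqrt : measurable_fun setT (@Num.sqrt R).
  by apply: continuous_measurable_fun; exact: sqrt_continuous.
apply: (measurableT_comp msqrt).
by apply: measurable_sum => i; apply: measurable_funM; exact: mX.
Qed.

Lemma measurable_vecB (X Y : T -> 'rV[R]_d) :
  measurable_vec X -> measurable_vec Y -> measurable_vec (fun t => X t - Y t).
Proof.
move=> mX mY i; under eq_fun do rewrite !mxE.
by apply: measurable_funB; [exact: mX|exact: mY].
Qed.

(** A function that is continuous in the point and measurable in the parameter
    is measurable along a measurable point.  Rounding the point down to a grid of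
    mesh [1 / n] leaves countably many points, for each of which the
    composition is measurable; then [n] tends to infinity. *)
Lemma measurable_caratheodory (h : 'rV[R]_d -> T -> R) (X : T -> 'rV[R]_d) :
  (forall x, measurable_fun setT (h x)) ->
  (forall t, continuous (h^~ t)) ->
  measurable_vec X -> measurable_fun setT (fun t => h (X t) t).
Proof.
move=> mh ch mX.
pose code (n : nat) (x : 'rV[R]_d) : 'rV[int]_d :=
  \row_i Num.floor (n.+1%:R * x 0 i).
pose grid (n : nat) (z : 'rV[int]_d) : 'rV[R]_d :=
  \row_i ((z 0 i)%:~R / n.+1%:R).
have mcode n z : measurable [set t | code n (X t) = z].
  have -> : [set t | code n (X t) = z] =
      \bigcap_(i in [set: 'I_d])
        (setT `&` (fun t => n.+1%:R * X t 0 i) @^-1`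
           [set` `[(z 0 i)%:~R, (z 0 i + 1)%:~R[]).
    apply/seteqP; split => t /=.
      by move=> <- i _; split => //=; rewrite in_itv/= mxE floor_itv.
    move=> tz; apply/rowP => i; rewrite mxE; apply: floor_def.
    by have [_] := tz i I; rewrite /= in_itv.
  apply: fin_bigcap_measurable => [|i _]; first exact: finite_finset.
  suff : measurable_fun setT (fun t => n.+1%:R * X t 0 i) by apply.
  by apply: measurable_funM => //; exact: mX.
apply: (@measurable_fun_cvg _ _ _ _ (fun n t => h (grid n (code n (X t))) t)).
  move=> n _ A mA; rewrite setTI.
  have -> : (fun t => h (grid n (code n (X t))) t) @^-1` A =
      \bigcup_z ([set t | code n (X t) = z] `&` (h (grid n z) @^-1` A)).
    apply/seteqP; split => t /=; first by exists (code n (X t)).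
    by move=> [z _ [/= <-]].
  apply: countable_bigcupT_measurable => [|z]; first exact: countableP.
  by apply: measurableI => //; rewrite -[_ @^-1` _]setTI; exact: mh.
move=> t _; apply: (@cvg_comp _ _ _ _ (h^~ t)); last exact: ch.
apply/cvg_ballP => e e0.
have /cvgrPdist_lt/(_ e e0) := @cvg_harmonic R.
apply: filterS => n; rewrite sub0r normrN ger0_norm ?harmonic_ge0// => ne.
split=> // i j; rewrite /ball/= !mxE (ord1 i).
have n0 : 0 < n.+1%:R :> R by rewrite ltr0n.
have /andP[] := floor_itv (n.+1%:R * X t 0 j).
rewrite intrD => lo hi; apply: le_lt_trans ne.
rewrite ger0_norm /harmonic/=.
  rewrite -(ler_pM2l n0) mulrBr mulfV ?gt_eqF// (mulrC _ (_ / _)) divfK ?gt_eqF//.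
  lra.
by rewrite subr_ge0 ler_pdivrMr// [leRHS]mulrC.
Qed.

(** A partial derivative is the limit of difference quotients with increments
    [1 / n]. *)
Lemma cvg_diff_quotient (h : 'rV[R]_d -> R) (x : 'rV[R]_d) (i : 'I_d) :
  differentiable h x ->
  n.+1%:R * (h (n.+1%:R^-1 *: delta_mx 0 i + x) - h x) @[n --> \oo]
    --> grad h x 0 i.
Proof.
move=> dh; rewrite mxE.
have /cvg_ex [l hl] := @diff_derivable _ _ _ _ _ (delta_mx 0 i) dh.
rewrite /derive (cvg_lim _ hl)//.
have /cvgr_dnbhsP/(_ (fun n => n.+1%:R^-1))h1 := hl.
rewrite (_ : (fun n => _) = (fun n => (n.+1%:R^-1)^-1 *:
  ((h \o shift x) (n.+1%:R^-1 *: delta_mx 0 i) - h x))); last first.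
  by apply/funext => n; rewrite invrK.
apply: h1; split; last exact: cvg_harmonic.
by move=> n; rewrite invr_neq0// pnatr_eq0.
Qed.

Lemma measurable_grad (h : 'rV[R]_d -> T -> R) (X : T -> 'rV[R]_d) :
  (forall x, measurable_fun setT (h x)) ->
  (forall t x, differentiable (h^~ t) x) ->
  measurable_vec X -> measurable_vec (fun t => grad (h^~ t) (X t)).
Proof.
move=> mh dh mX i.
have ch t : continuous (h^~ t) by move=> x; exact/differentiable_continuous.
apply: (@measurable_fun_cvg _ _ _ _ (fun n t => n.+1%:R *
    (h (n.+1%:R^-1 *: delta_mx 0 i + X t) t - h (X t) t))).
  move=> n; apply: measurable_funM => //; apply: measurable_funB.
    apply: measurable_caratheodory => // j.
    under eq_fun do rewrite !mxE.
    by apply: measurable_funD => //; exact: mX.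
  exact: measurable_caratheodory.
by move=> t _; apply: cvg_diff_quotient.
Qed.

End Measurability.

Lemma measurable_batch_mean (R : realType) (d : nat)
    (dX : measure_display) (Xi : measurableType dX) (f : 'rV[R]_d -> Xi -> R)
    (dT : measure_display) (T : measurableType dT) (B : nat)
    (X : T -> 'rV[R]_d) (zeta : 'I_B -> T -> Xi) :
  (forall x, measurable_fun setT (f x)) ->
  (forall xi x, differentiable (f^~ xi) x) ->
  measurable_vec X -> (forall i, measurable_fun setT (zeta i)) ->
  measurable_vec
    (fun t => B%:R^-1 *: \sum_i grad (f^~ (zeta i t)) (X t)).
Proof.
move=> mf df mX mz j.
under eq_fun do rewrite !mxE summxE.
apply: measurable_funM => //; apply: measurable_sum => i.
apply: (@measurable_grad _ _ _ _ (fun x t => f x (zeta i t))) => // x.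
exact: measurableT_comp.
Qed.

(** The samples are functions on an arbitrary space [T], so that the lemma also
    applies to [Omega] with only the events of the first [k] batches. *)
Lemma measurable_nsgd (R : realType) (d : nat)
    (dX : measure_display) (Xi : measurableType dX) (f : 'rV[R]_d -> Xi -> R)
    (dT : measure_display) (T : measurableType dT) (B : nat) (eta lambda : R)
    (x0 : 'rV[R]_d) (zeta : nat -> 'I_B -> T -> Xi) (k : nat) :
  0 < lambda ->
  (forall x, measurable_fun setT (f x)) ->
  (forall xi x, differentiable (f^~ xi) x) ->
  (forall j i, (j < k)%N -> measurable_fun setT (zeta j i)) ->
  measurable_vec (fun t => nsgd f eta lambda x0 (fun j i => zeta j i t) k).
Proof.
move=> lam0 mf df; elim: k => [_ i|k IH mz]; first exact: measurable_cst.
have {}IH := IH (fun j i jk => mz j i (ltnW jk)).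
have mg := measurable_batch_mean mf df IH (fun i => mz k i (ltnSn k)).
have mstep : measurable_fun setT (fun r : R => eta / (`|r| + lambda)).
  apply: continuous_measurable_fun => r; apply: cvgM; first exact: cvg_cst.
  apply: cvgV; first by rewrite gt_eqF// ltr_wpDl.
  by apply: cvgD; [exact: norm_continuous|exact: cvg_cst].
move=> i /=; set g := (fun t => _ *: _) in mg.
rewrite (_ : (fun t => _) = (fun t =>
  nsgd f eta lambda x0 (fun j i => zeta j i t) k 0 i -
  eta / (`|enorm (g t)| + lambda) * g t 0 i)); last first.
  by apply/funext => t; rewrite /g ger0_norm ?enorm_ge0// !mxE.
apply: measurable_funB; first exact: IH.
apply: measurable_funM; last exact: mg.
by apply: (measurableT_comp mstep); exact: measurable_enorm.
Qed.

(** * Independence *)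

Section IndependentPair.
Context {R : realType} {dO d1 d2 : measure_display} {Omega : measurableType dO}
  {T1 : measurableType d1} {T2 : measurableType d2} (P : probability Omega R).

Definition indep_pair (X : {RV P >-> T1}) (Y : {RV P >-> T2}) :=
  forall A1 A2, measurable A1 -> measurable A2 ->
    P ((X @^-1` A1) `&` (Y @^-1` A2)) = (P (X @^-1` A1) * P (Y @^-1` A2))%E.

Variables (X : {RV P >-> T1}) (Y : {RV P >-> T2}).

Let XY_measurable : measurable_fun setT (fun w => (X w, Y w)).
Proof. exact: measurable_fun_pair. Qed.

Let XY : {RV P >-> (T1 * T2)%type} :=
  HB.pack (fun w => (X w, Y w))
    (isMeasurableFun.Build _ _ _ _ _ XY_measurable).

Hypothesis XYi : indep_pair X Y.

Let joint_law S : measurable S ->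
  (distribution P X \x distribution P Y)%E S = distribution P XY S.
Proof. by apply: product_measure_unique => A1 A2 mA1 mA2; exact: XYi. Qed.

(** Tonelli's theorem for the joint law of [X] and [Y], which is the product of
    their laws. *)
Lemma indep_pair_integral_le (phi : T1 * T2 -> \bar R) (c : Omega -> \bar R) :
  measurable_fun setT phi -> (forall z, 0 <= phi z)%E -> measurable_fun setT c ->
  (forall w, \int[P]_w' phi (X w, Y w') <= c w)%E ->
  (\int[P]_w phi (X w, Y w) <= \int[P]_w c w)%E.
Proof.
move=> mphi phi0 mc hc.
rewrite -(ge0_integral_distribution XY mphi phi0).
rewrite -(eq_measure_integral _ (fun S mS _ => joint_law mS)).
have mF : measurable_fun setT (fubini_F (distribution P Y) phi).
  exact: measurable_fun_fubini_tonelli_F.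
have FE w : fubini_F (distribution P Y) phi (X w) =
            (\int[P]_w' phi (X w, Y w'))%E.
  by rewrite /fubini_F ge0_integral_distribution//; exact: measurableT_comp.
rewrite fubini_tonelli1// ge0_integral_distribution//; last first.
  by move=> x; apply: integral_ge0.
apply: ge0_le_integral => //.
- by move=> w _; apply: integral_ge0.
- exact: measurableT_comp.
- by move=> w _ /=; rewrite FE.
Qed.

Lemma indep_pair_uncorrelated (a : T1 -> R) (b : T2 -> R) :
  measurable_fun setT a -> measurable_fun setT b ->
  P.-integrable setT (EFin \o (fun w => a (X w) * b (Y w))) ->
  P.-integrable setT (EFin \o (fun w => b (Y w))) ->
  \int[P]_w b (Y w) = 0 -> \int[P]_w (a (X w) * b (Y w)) = 0.
Proof.
move=> ma mb iab ib b0.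
pose phi (z : T1 * T2) : \bar R := (a z.1 * b z.2)%:E.
have mphi : measurable_fun setT phi.
  by apply/measurable_EFinP/measurable_funM; exact: measurableT_comp.
have iphi : (distribution P X \x distribution P Y)%E.-integrable setT phi.
  apply/integrableP; split=> //.
  rewrite (eq_measure_integral (distribution P XY)); last first.
    by move=> S mS _; exact: joint_law.
  rewrite ge0_integral_distribution//; last exact: measurableT_comp.
  by have /integrableP[] := iab.
rewrite /Rintegral.
rewrite (_ : (\int[P]_w _)%E = \int[distribution P XY]_z phi z)%E; last first.
  by rewrite integral_distribution.
rewrite -(eq_measure_integral _ (fun S mS _ => joint_law mS)).
rewrite -integral12_prod_meas1//.
rewrite integral0_eq// => x _; rewrite /fubini_F /phi/=.
under eq_integral do rewrite EFinM.
have ibD : (distribution P Y).-integrable setT (EFin \o b).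
  apply/integrableP; split; first exact/measurable_EFinP.
  rewrite ge0_integral_distribution//.
    by have /integrableP[] := ib.
  by apply: measurableT_comp => //; exact/measurable_EFinP.
rewrite integralZl// integral_distribution//; last exact/measurable_EFinP.
rewrite -(fineK (integrable_fin_num _ ib))//.
rewrite (_ : fine _ = 0) ?mule0//.
Qed.

End IndependentPair.

Section IndependentBatches.
Context {R : realType} {dO dX : measure_display} {Omega : measurableType dO}
  {Xi : measurableType dX} (P : probability Omega R) {I : eqType}
  (X : I -> {RV P >-> Xi}).

(** The events on finitely many coordinates: a generator, closed under
    intersection, of the sigma-algebra of the variables listed in [s]. *)
Definition cylinders (s : seq I) : set (set Omega) :=
  [set C | exists A : I -> set Xi, (forall i, measurable (A i)) /\
     C = \bigcap_(i in [set` s]) (X i @^-1` A i)].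

Lemma cylinders_measurable s : cylinders s `<=` measurable.
Proof.
move=> _ [A [mA ->]]; apply: fin_bigcap_measurable => [|i _].
  exact: finite_seq.
by rewrite -[_ @^-1` _]setTI; exact: measurable_funPT.
Qed.

Lemma cylinders_setI s : setI_closed (cylinders s).
Proof.
move=> _ _ [A [mA ->]] [A' [mA' ->]]; exists (fun i => A i `&` A' i); split.
  by move=> i; exact: measurableI.
by rewrite -bigcapI; apply: eq_bigcapr => i _; rewrite preimage_setI.
Qed.

Lemma cylinders_setT s : cylinders s setT.
Proof.
by exists (fun=> setT); split=> //; apply/seteqP; split.
Qed.

Lemma sigma_cylinders_measurable s : <<s cylinders s >> `<=` measurable.
Proof.
apply: smallest_sub; first exact: sigma_algebra_measurable.
exact: cylinders_measurable.
Qed.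

Lemma cylinders_preimage s i A :
  i \in s -> measurable A -> <<s cylinders s >> (X i @^-1` A).
Proof.
move=> si mA; apply: sub_sigma_algebra.
exists (fun j => if j == i then A else setT); split.
  by move=> j; case: ifP.
apply/seteqP; split => w /=.
  by move=> Aw j _ /=; case: eqP => // ->.
by move=> /(_ i si)/=; rewrite eqxx.
Qed.

Hypothesis Xind : mutually_independent X.

Lemma cylinders_indep s1 s2 C1 C2 : uniq (s1 ++ s2) ->
  cylinders s1 C1 -> cylinders s2 C2 -> P (C1 `&` C2) = (P C1 * P C2)%E.
Proof.
rewrite cat_uniq => /and3P[u1 s12 u2] [A1 [mA1 ->]] [A2 [mA2 ->]].
pose A i := if i \in s1 then A1 i else A2 i.
have E1 : \bigcap_(i in [set` s1]) (X i @^-1` A1 i) =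
          \bigcap_(i in [set` s1]) (X i @^-1` A i).
  by apply: eq_bigcapr => i /= si; rewrite /A si.
have n2 i : i \in s2 -> (i \in s1) = false.
  by move=> s2i; apply/negbTE; apply: contra s12 => s1i; apply/hasP; exists i.
have E2 : \bigcap_(i in [set` s2]) (X i @^-1` A2 i) =
          \bigcap_(i in [set` s2]) (X i @^-1` A i).
  by apply: eq_bigcapr => i /= si; rewrite /A n2.
have mA i : measurable (A i) by rewrite /A; case: ifP.
rewrite E1 E2 -bigcap_setU (_ : _ `|` _ = [set` s1 ++ s2]); last first.
  by apply/seteqP; split => i /=; rewrite mem_cat => /orP.
by rewrite !Xind ?big_cat// cat_uniq u1 s12.
Qed.

(** Disjoint lists of variables generate independent sigma-algebras: both sides
    of the product rule are finite measures in each of the two events, and the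
    cylinders determine such measures. *)
Lemma sigma_cylinders_indep s1 s2 E1 E2 : uniq (s1 ++ s2) ->
  <<s cylinders s1 >> E1 -> <<s cylinders s2 >> E2 ->
  P (E1 `&` E2) = (P E1 * P E2)%E.
Proof.
move=> u12.
have fineP E : measurable E -> P E = (fine (P E))%:E.
  by move=> mE; rewrite fineK// fin_num_measure.
have extend s (E : set Omega) (mE : measurable E) :
    (forall C, cylinders s C -> P (C `&` E) = (P C * P E)%E) ->
    forall C, <<s cylinders s >> C -> P (C `&` E) = (P C * P E)%E.
  move=> h C sC.
  have p0 : 0 <= fine (P E) by rewrite fine_ge0.
  pose m2 : {measure set Omega -> \bar R} := mscale (NngNum p0) P.
  transitivity (m2 C); last by rewrite /m2/= /mscale/= -fineP// muleC.
  pose m1 : {measure set Omega -> \bar R} := mrestr P mE.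
  transitivity (m1 C) => //.
  apply: (g_sigma_algebra_measure_unique (cylinders s) _ (fun=> setT)) => //.
  - exact: cylinders_measurable.
  - by move=> _; exact: cylinders_setT.
  - by rewrite bigcup_const.
  - exact: cylinders_setI.
  - by move=> A cA; rewrite /m1 /m2/= /mrestr /mscale/= h// -fineP// muleC.
  - by move=> _; rewrite /m1/= /mrestr setTI fineP// ltry.
move=> sE1 sE2.
have mE2 := sigma_cylinders_measurable sE2.
apply: (extend _ _ _ _ _ sE1) => // C1 cC1.
rewrite setIC muleC; have mC1 := cylinders_measurable cC1.
apply: (extend _ _ _ _ _ sE2) => // C2 cC2; rewrite setIC muleC.
exact: cylinders_indep cC1 cC2.
Qed.

(** [Omega] with the events that only depend on the variables of [s]. *)
Definition observed (s : seq I) : measurableType _ :=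
  g_sigma_algebraType (cylinders s).

Lemma measurable_observed s i : i \in s ->
  measurable_fun setT (X i : observed s -> Xi).
Proof. by move=> si _ A mA; rewrite setTI; exact: (cylinders_preimage si mA). Qed.

Lemma measurable_forget s : measurable_fun setT (idfun : Omega -> observed s).
Proof. by move=> _ A mA; rewrite setTI; exact: (sigma_cylinders_measurable mA). Qed.

Definition forget s : {RV P >-> observed s} :=
  HB.pack (idfun : Omega -> observed s)
    (isMeasurableFun.Build _ _ _ _ _ (@measurable_forget s)).

(** By independence the variables of [s2] can be averaged while those of [s1]
    are held fixed.  The joint law behind this is that of the diagonal map of
    [Omega] into the product of two coarser copies of [Omega]. *)
Lemma freezing s1 s2 (phi : observed s1 * observed s2 -> \bar R)
    (c : Omega -> \bar R) :
  uniq (s1 ++ s2) -> measurable_fun setT phi -> (forall z, 0 <= phi z)%E ->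
  measurable_fun setT c -> (forall w, \int[P]_w' phi (w, w') <= c w)%E ->
  (\int[P]_w phi (w, w) <= \int[P]_w c w)%E.
Proof.
move=> u12; apply: (indep_pair_integral_le (X := forget s1) (Y := forget s2)).
by move=> A1 A2 mA1 mA2; exact: sigma_cylinders_indep u12 mA1 mA2.
Qed.

Lemma mutually_indep_pair i j : i != j -> indep_pair (X i) (X j).
Proof.
move=> ij A1 A2 mA1 mA2.
apply: (@sigma_cylinders_indep [:: i] [:: j]).
- by rewrite /= inE ij.
- by apply: cylinders_preimage; rewrite ?inE.
- by apply: cylinders_preimage; rewrite ?inE.
Qed.

End IndependentBatches.

(** * Second moments *)

Section Integration.
Context {R : realType} {dT : measure_display} {T : measurableType dT}.
Implicit Types (u v : T -> R).

Lemma ae_le_Rintegral (mu : {measure set T -> \bar R}) u v :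
  mu.-integrable setT (EFin \o u) -> mu.-integrable setT (EFin \o v) ->
  {ae mu, forall t, u t <= v t} -> \int[mu]_t u t <= \int[mu]_t v t.
Proof.
move=> iu iv [N [mN N0 uvN]].
have uf := integrable_fin_num measurableT iu.
have vf := integrable_fin_num measurableT iv.
apply: fine_le => //; rewrite (negligible_integral mN)//.
rewrite [leRHS](negligible_integral mN)//.
have mD : measurable (setT `\` N) by exact: measurableD.
apply: le_integral => //.
- exact: integrableS iu.
- exact: integrableS iv.
move=> t; rewrite inE => -[_ Nt]; rewrite lee_fin.
by apply: contrapT => uv; apply: Nt; apply: uvN.
Qed.

Lemma Rintegral_sum (mu : {measure set T -> \bar R}) (I : Type) (s : seq I)
    (h : I -> T -> R) :
  (forall i, mu.-integrable setT (EFin \o h i)) ->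
  \int[mu]_t (\sum_(i <- s) h i t) = \sum_(i <- s) \int[mu]_t h i t.
Proof.
move=> ih; elim: s => [|i s IH].
  under eq_Rintegral do rewrite big_nil.
  by rewrite big_nil Rintegral_cst// mul0r.
under eq_Rintegral do rewrite big_cons.
rewrite big_cons RintegralD ?IH//.
rewrite (_ : _ \o _ = (fun t => \sum_(j <- s) (EFin \o h j) t)%E); last first.
  by apply/funext => t /=; rewrite sumEFin.
exact: integrable_sum.
Qed.

Lemma integrableR_sum (mu : {measure set T -> \bar R}) (I : Type) (s : seq I)
    (h : I -> T -> R) :
  (forall i, mu.-integrable setT (EFin \o h i)) ->
  mu.-integrable setT (EFin \o (fun t => \sum_(i <- s) h i t)).
Proof.
move=> ih; rewrite (_ : _ \o _ = (fun t => \sum_(j <- s) (EFin \o h j) t)%E).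
  exact: integrable_sum.
by apply/funext => t /=; rewrite sumEFin.
Qed.

Lemma integrableRD (mu : {measure set T -> \bar R}) u v :
  mu.-integrable setT (EFin \o u) -> mu.-integrable setT (EFin \o v) ->
  mu.-integrable setT (EFin \o (fun t => u t + v t)).
Proof. by move=> iu iv; exact: (integrableD measurableT iu iv). Qed.

Lemma integrableRZ (mu : {measure set T -> \bar R}) (a : R) u :
  mu.-integrable setT (EFin \o u) ->
  mu.-integrable setT (EFin \o (fun t => a * u t)).
Proof. by move=> iu; exact: (integrableZl measurableT a iu). Qed.

Definition square_integrable (mu : {measure set T -> \bar R}) u :=
  measurable_fun setT u /\ mu.-integrable setT (EFin \o (fun t => u t ^+ 2)).

Lemma square_integrable_mul (mu : {measure set T -> \bar R}) u v :
  square_integrable mu u -> square_integrable mu v ->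
  mu.-integrable setT (EFin \o (fun t => u t * v t)).
Proof.
move=> [mu_ iu] [mv iv]; apply: (le_integrable _ _ _ (integrableRD iu iv)) => //.
  by apply/measurable_EFinP/measurable_funM.
move=> t _ /=; rewrite lee_fin [leRHS]ger0_norm ?addr_ge0 ?sqr_ge0//.
by rewrite ler_norml; apply/andP; split; nra.
Qed.

Lemma square_integrableD (mu : {measure set T -> \bar R}) u v :
  square_integrable mu u -> square_integrable mu v ->
  square_integrable mu (fun t => u t + v t).
Proof.
move=> su sv; split; first by apply: measurable_funD; [exact: su.1|exact: sv.1].
rewrite (_ : _ \o _ =
    EFin \o (fun t => (u t ^+ 2 + v t ^+ 2) + 2 * (u t * v t))); last first.
  by apply/funext => t /=; congr EFin; ring.
apply: integrableRD; last by apply: integrableRZ; exact: square_integrable_mul.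
by apply: integrableRD; [exact: su.2|exact: sv.2].
Qed.

Lemma integrable_cstR (mu : probability T R) (a : R) :
  mu.-integrable setT (EFin \o (fun=> a)).
Proof. exact: finite_measure_integrable_cst. Qed.

Lemma Rintegral_cst1 (mu : probability T R) (a : R) : \int[mu]_t a = a.
Proof.
have mu1 : (mu : {measure set T -> \bar R}) setT = 1%E.
  exact: probability_setT.
by rewrite Rintegral_cst// mu1 mulr1.
Qed.

Lemma square_integrable_cst (mu : probability T R) (a : R) :
  square_integrable mu (fun=> a).
Proof. by split; [exact: measurable_cst|exact: integrable_cstR]. Qed.

Lemma square_integrable_integrable (mu : probability T R) u :
  square_integrable mu u -> mu.-integrable setT (EFin \o u).
Proof.
move=> su; rewrite (_ : u = (fun t => u t * 1)); last first.
  by apply/funext => t; rewrite mulr1.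
by apply: square_integrable_mul => //; exact: square_integrable_cst.
Qed.

Lemma Rintegral_centered_sqr (mu : probability T R) u (m : R) :
  square_integrable mu u -> \int[mu]_t u t = m ->
  \int[mu]_t ((u t - m) ^+ 2) = \int[mu]_t (u t ^+ 2) - m ^+ 2.
Proof.
move=> su um; have iu := square_integrable_integrable su.
transitivity (\int[mu]_t ((u t ^+ 2 + - (2 * m) * u t) + m ^+ 2)).
  by apply: eq_Rintegral => t _; ring.
rewrite !RintegralD//; try exact: integrable_cstR.
- by rewrite RintegralZl// um Rintegral_cst1; ring.
- exact: su.2.
- exact: integrableRZ.
- by apply: integrableRD; [exact: su.2|exact: integrableRZ].
Qed.

(** Jensen's inequality for the square, from [2 y <= y ^ 2 / c + c]
    applied to [c + e] with [e > 0], as [c] may vanish. *)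
Lemma mean_le_of_second_moment (mu : probability T R) u (c : R) :
  0 <= c -> measurable_fun setT u -> (forall t, 0 <= u t) ->
  (\int[mu]_t (u t ^+ 2)%:E <= (c ^+ 2)%:E)%E ->
  (\int[mu]_t (u t)%:E <= c%:E)%E.
Proof.
move=> c0 mu_ u0 hc; apply/lee_addgt0Pr => e e0.
have ce0 : 0 < c + e by lra.
have cst0 : 0 <= (2 * (c + e))^-1 by rewrite invr_ge0; lra.
apply: (@le_trans _ _ (\int[mu]_t (((2 * (c + e))^-1)%:E * (u t ^+ 2)%:E
                                   + ((c + e) / 2)%:E))%E).
  apply: ge0_le_integral => //.
  - by move=> t _; rewrite lee_fin.
  - exact/measurable_EFinP.
  - apply: emeasurable_funD => //; apply: emeasurable_funM => //.
    by apply/measurable_EFinP; exact: measurable_funX.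
  - move=> t _; rewrite -EFinM -EFinD lee_fin.
    have -> : (2 * (c + e))^-1 * u t ^+ 2 + (c + e) / 2 =
              u t + (u t - (c + e)) ^+ 2 / (2 * (c + e)) by field; lra.
    by rewrite lerDl divr_ge0 ?sqr_ge0//; lra.
rewrite ge0_integralD//; last 3 first.
- by move=> t _; rewrite -EFinM lee_fin mulr_ge0 ?sqr_ge0.
- apply: emeasurable_funM => //.
  by apply/measurable_EFinP; exact: measurable_funX.
- by move=> t _; rewrite lee_fin; lra.
rewrite ge0_integralZl//; last 2 first.
- by apply/measurable_EFinP; exact: measurable_funX.
- by move=> t _; rewrite lee_fin sqr_ge0.
have mu1 : (mu : {measure set T -> \bar R}) setT = 1%E.
  exact: probability_setT.
rewrite integral_cst// mu1 mule1.
apply: (@le_trans _ _ (((2 * (c + e))^-1)%:E * (c ^+ 2)%:E + ((c + e) / 2)%:E)%E).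
  by rewrite leeD2r// lee_wpmul2l// lee_fin.
rewrite -EFinM -!EFinD lee_fin.
have -> : (2 * (c + e))^-1 * c ^+ 2 + (c + e) / 2 =
   c + e - ((c + e) ^+ 2 - c ^+ 2) / (2 * (c + e)) by field; lra.
by rewrite gerBl divr_ge0//; nra.
Qed.

End Integration.

Section Law.
Context {R : realType} {dO dX : measure_display} {Omega : measurableType dO}
  {Xi : measurableType dX} (P : probability Omega R) (D : probability Xi R)
  (X : {RV P >-> Xi}).
Hypothesis XD : forall A, measurable A -> distribution P X A = D A.

Lemma law_ge0_integral (h : Xi -> \bar R) :
  measurable_fun setT h -> (forall z, 0 <= h z)%E ->
  (\int[P]_w h (X w) = \int[D]_z h z)%E.
Proof.
move=> mh h0; rewrite -(eq_measure_integral _ (fun A mA _ => XD mA)).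
by rewrite ge0_integral_distribution.
Qed.

Lemma law_integrable (u : Xi -> R) : D.-integrable setT (EFin \o u) ->
  P.-integrable setT (EFin \o (fun w => u (X w))).
Proof.
move=> /integrableP[mu_ iu].
have mu' : measurable_fun setT u by exact/measurable_EFinP.
apply/integrableP; split; first by apply/measurable_EFinP; exact: measurableT_comp.
rewrite (law_ge0_integral (h := fun z => `|(u z)%:E|%E))//.
exact: measurableT_comp.
Qed.

Lemma law_Rintegral (u : Xi -> R) : D.-integrable setT (EFin \o u) ->
  \int[P]_w u (X w) = \int[D]_z u z.
Proof.
move=> iu; rewrite /Rintegral -(eq_measure_integral _ (fun A mA _ => XD mA)).
rewrite (integral_distribution (f := fun z => (u z)%:E))//.
  exact: measurable_int iu.
exact: law_integrable.
Qed.

Lemma law_square_integrable (u : Xi -> R) :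
  square_integrable D u -> square_integrable P (fun w => u (X w)).
Proof.
move=> [mu_ iu]; split; first exact: measurableT_comp.
exact: (law_integrable (u := fun z => u z ^+ 2)).
Qed.

Lemma law_ae (Q : Xi -> Prop) :
  {ae D, forall z, Q z} -> {ae P, forall w, Q (X w)}.
Proof.
move=> [N [mN N0 QN]]; exists (X @^-1` N); split.
- by rewrite -[_ @^-1` _]setTI; exact: measurable_funPT.
- by rewrite -N0 -XD.
- by move=> w nQ; apply: QN.
Qed.

End Law.

(** Averaging a batch of pairwise independent samples divides the variance by
    its size, because the cross terms vanish. *)
Lemma batch_variance (R : realType) (dO dX : measure_display)
    (Omega : measurableType dO) (Xi : measurableType dX)
    (P : probability Omega R) (D : probability Xi R) (B : nat)
    (X : 'I_B -> {RV P >-> Xi}) (u : Xi -> R) (m : R) :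
  (0 < B)%N ->
  (forall i A, measurable A -> distribution P (X i) A = D A) ->
  (forall i j, i != j -> indep_pair (X i) (X j)) ->
  square_integrable D u -> \int[D]_z u z = m ->
  P.-integrable setT
    (EFin \o (fun w => (B%:R^-1 * (\sum_i u (X i w)) - m) ^+ 2)) /\
  \int[P]_w ((B%:R^-1 * (\sum_i u (X i w)) - m) ^+ 2) =
  B%:R^-1 * (\int[D]_z (u z ^+ 2) - m ^+ 2).
Proof.
move=> B0 XD Xi_ su um.
have BR0 : B%:R != 0 :> R by rewrite pnatr_eq0 -lt0n.
pose c z := u z - m.
have sc : square_integrable D c.
  by apply: square_integrableD => //; exact: square_integrable_cst.
have mc : measurable_fun setT c by exact: sc.1.
have ic := square_integrable_integrable sc.
have c0 : \int[D]_z c z = 0.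
  rewrite /c RintegralD ?um ?Rintegral_cst1 ?subrr//.
  - exact: square_integrable_integrable.
  - exact: integrable_cstR.
have sX i := law_square_integrable (XD i) sc.
have iX i j := square_integrable_mul (sX i) (sX j).
have E w : (B%:R^-1 * (\sum_i u (X i w)) - m) ^+ 2 =
    B%:R^-1 ^+ 2 * \sum_i \sum_j (c (X i w) * c (X j w)).
  have -> : B%:R^-1 * (\sum_i u (X i w)) - m = B%:R^-1 * \sum_i c (X i w).
    by rewrite sumrB sumr_const card_ord -mulr_natr; field.
  rewrite exprMn; congr (_ * _); rewrite expr2 mulr_suml.
  by apply: eq_bigr => i _; rewrite mulr_sumr.
have isum : P.-integrable setT
    (EFin \o (fun w => \sum_i \sum_j (c (X i w) * c (X j w)))).
  by apply: integrableR_sum => i; apply: integrableR_sum => j.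
split.
  by under eq_fun do rewrite E; exact: integrableRZ.
under eq_Rintegral do rewrite E.
rewrite RintegralZl// Rintegral_sum; last by move=> i; exact: integrableR_sum.
under eq_bigr => i _.
  rewrite Rintegral_sum// (bigD1 i)//= big1 ?addr0; last first.
    move=> j ji; apply: (indep_pair_uncorrelated (X := X i) (Y := X j)) => //.
    - by apply: Xi_; rewrite eq_sym.
    - exact: (law_integrable (XD j) ic).
    - by rewrite (law_Rintegral (XD j) ic).
  under eq_Rintegral do rewrite -expr2.
  rewrite (law_Rintegral (XD i) sc.2) Rintegral_centered_sqr//.
  over.
rewrite sumr_const card_ord -mulr_natr; field; exact: BR0.
Qed.

(** * The stochastic gradient oracle *)

Section StepSize.
Context {R : realType}.
Variables (L0 L1 rho lambda eta : R).
Hypotheses (L0_ge0 : 0 <= L0) (L1_ge0 : 0 <= L1) (rho_ge1 : 1 <= rho)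
  (lambda_gt0 : 0 < lambda) (eta_gt0 : 0 < eta)
  (eta_le : (eta%:E <= lambda%:E / (L0 + Num.sqrt rho * L1 * lambda)%:E)%E).

Lemma sqrt_rho_ge1 : 1 <= Num.sqrt rho.
Proof. by rewrite -[leLHS]sqrtr1 ler_wsqrtr. Qed.

Lemma step_size_le : eta * (L0 + Num.sqrt rho * L1 * lambda) <= lambda.
Proof.
move: eta_le; set q := L0 + _ => h.
have q0 : 0 <= q by rewrite addr_ge0// !mulr_ge0 ?sqrtr_ge0// ltW.
have [->|qn0] := eqVneq q 0; first by rewrite mulr0 ltW.
have q_gt0 : 0 < q by rewrite lt0r qn0.
by move: h; rewrite inver (negbTE qn0) -EFinM lee_fin ler_pdivlMr.
Qed.

Lemma step_size_L0 : eta * L0 <= lambda.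
Proof.
apply: le_trans step_size_le; rewrite ler_pM2l// lerDl.
by rewrite !mulr_ge0 ?sqrtr_ge0// ltW.
Qed.

Lemma step_size_sqrt_rho_L1 : eta * (Num.sqrt rho * L1) <= 1.
Proof.
rewrite -(ler_pM2r lambda_gt0) mul1r -mulrA; apply: le_trans step_size_le.
by rewrite ler_pM2l// lerDr.
Qed.

Lemma step_size_L1 : eta * L1 <= 1.
Proof.
apply: le_trans step_size_sqrt_rho_L1; rewrite ler_pM2l//.
by rewrite ler_peMl// sqrt_rho_ge1.
Qed.

(** The smoothness inequality applies to every step, whose length is less than
    [eta <= 1 / (sqrt rho * L1) <= 1 / L1]. *)
Lemma step_size_radius (r : R) : r <= eta -> (r%:E <= (L1%:E)^-1)%E.
Proof.
move=> r_eta; rewrite inver; case: ifPn => [_|L1n0]; first exact: leey.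
have L1_gt0 : 0 < L1 by rewrite lt0r L1n0.
rewrite lee_fin (le_trans r_eta)// -[leRHS]mul1r ler_pdivlMr//.
exact: step_size_L1.
Qed.

End StepSize.

Section Oracle.
Context {R : realType} {d : nat} {dX : measure_display} {Xi : measurableType dX}
  (D : probability Xi R) (f : 'rV[R]_d -> Xi -> R) (F : 'rV[R]_d -> R).
Hypotheses
  (f_integrable : forall x, D.-integrable setT (EFin \o f x))
  (F_expectation : forall x, (F x)%:E = ('E_D[f x])%E)
  (f_differentiable : forall xi x, differentiable (f^~ xi) x).
Variables (L0 L1 : R).
Hypotheses
  (f_smooth : {ae D, forall xi, smooth_convex L0 L1 (f^~ xi)})
  (unbiased : forall x (j : 'I_d),
      ('E_D[fun xi => (grad (f^~ xi) x 0 j)%R])%E = (grad F x 0 j)%:E).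
Variable (rho : R).
Hypothesis
  (strong_growth : forall x,
      ('E_D[fun xi => (enorm (grad (f^~ xi) x) ^+ 2)%R]
       <= (rho * enorm (grad F x) ^+ 2)%:E)%E).

Local Notation gradf x := (fun xi => grad (f^~ xi) x).

Lemma measurable_objective x : measurable_fun setT (f x).
Proof. by apply/measurable_EFinP; exact: measurable_int (f_integrable x). Qed.

Lemma measurable_gradf x : measurable_vec (gradf x).
Proof.
apply: (@measurable_grad _ _ _ _ f (fun=> x)) => //.
exact: measurable_objective.
Qed.

Lemma Rintegral_objective x : \int[D]_xi f x xi = F x.
Proof.
apply: EFin_inj; rewrite F_expectation unlock /Rintegral fineK//.
exact: (integrable_fin_num measurableT (f_integrable x)).
Qed.

Lemma enorm_gradf_second_moment x :
  (\int[D]_xi (enorm (grad (f^~ xi) x) ^+ 2)%:E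
   <= (rho * enorm (grad F x) ^+ 2)%:E)%E.
Proof. by have := strong_growth x; rewrite unlock. Qed.

Lemma square_integrable_enorm_gradf x :
  square_integrable D (fun xi => enorm (gradf x xi)).
Proof.
have men := measurable_enorm (measurable_gradf x).
split=> //; apply/integrableP; split.
  by apply/measurable_EFinP; exact: measurable_funX.
apply: le_lt_trans (ltry _); apply: le_trans (enorm_gradf_second_moment x).
rewrite le_eqVlt; apply/orP; left; apply/eqP.
by apply: eq_integral => xi _ /=; rewrite ger0_norm// sqr_ge0.
Qed.

Lemma square_integrable_gradf x j :
  square_integrable D (fun xi => gradf x xi 0 j).
Proof.
have [_ ie] := square_integrable_enorm_gradf x.
have mg := measurable_gradf x j.
split=> //; apply: (le_integrable _ _ _ ie) => //.
  by apply/measurable_EFinP; exact: measurable_funX.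
move=> xi _ /=; rewrite lee_fin !ger0_norm ?sqr_ge0//.
rewrite -[leLHS]real_normK ?num_real// ler_pXn2r ?nnegrE ?enorm_ge0//.
exact: coord_le_enorm.
Qed.

Lemma Rintegral_gradf x j : \int[D]_xi gradf x xi 0 j = grad F x 0 j.
Proof. by have := unbiased x j; rewrite unlock /Rintegral => ->. Qed.

Lemma integrable_dot_gradf x v :
  D.-integrable setT (EFin \o (fun xi => dot (gradf x xi) v)).
Proof.
apply: integrableR_sum => j; under eq_fun do rewrite mulrC.
apply: integrableRZ; apply: square_integrable_integrable.
exact: square_integrable_gradf.
Qed.

Lemma Rintegral_dot_gradf x v :
  \int[D]_xi dot (gradf x xi) v = dot (grad F x) v.
Proof.
have ig j := square_integrable_integrable (square_integrable_gradf x j).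
rewrite Rintegral_sum; last first.
  by move=> j; under eq_fun do rewrite mulrC; exact: integrableRZ.
apply: eq_bigr => j _; under eq_Rintegral do rewrite mulrC.
by rewrite RintegralZl// Rintegral_gradf mulrC.
Qed.

Lemma Rintegral_sqr_enorm_gradf_le x :
  \int[D]_xi (enorm (gradf x xi) ^+ 2) <= rho * enorm (grad F x) ^+ 2.
Proof.
have ie := (square_integrable_enorm_gradf x).2.
rewrite -lee_fin fineK; first exact: enorm_gradf_second_moment.
exact: (integrable_fin_num measurableT ie).
Qed.

Hypothesis rho_ge1 : 1 <= rho.

Lemma Rintegral_enorm_gradf_le x :
  \int[D]_xi enorm (gradf x xi) <= Num.sqrt rho * enorm (grad F x).
Proof.
have se := square_integrable_enorm_gradf x.
rewrite -lee_fin fineK; last first.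
  exact: (integrable_fin_num measurableT (square_integrable_integrable se)).
apply: mean_le_of_second_moment => //.
- by rewrite mulr_ge0 ?sqrtr_ge0// enorm_ge0.
- exact: se.1.
- by move=> xi; exact: enorm_ge0.
rewrite exprMn sqr_sqrtr ?(le_trans ler01)//.
exact: enorm_gradf_second_moment.
Qed.

Section Regularity.
Variable eta : R.
Hypotheses (L0_ge0 : 0 <= L0) (L1_ge0 : 0 <= L1) (eta_gt0 : 0 < eta)
  (eta_radius : forall r, r <= eta -> (r%:E <= (L1%:E)^-1)%E).

Lemma objective_convex x y : F x + dot (grad F x) (y - x) <= F y.
Proof.
rewrite -!Rintegral_objective -Rintegral_dot_gradf.
have id := integrable_dot_gradf x (y - x).
rewrite -RintegralD//; apply: ae_le_Rintegral => //.
  by apply: integrableRD.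
apply: filterS f_smooth => xi /(_ x y y)[]//.
by apply: eta_radius; rewrite subrr enorm0 ltW.
Qed.

(** Averaging the smoothness inequality replaces [|grad (f _ xi) z|] by its
    mean, which the strong growth condition bounds by
    [sqrt rho * |grad F z|]. *)
Lemma objective_smooth y z : enorm (y - z) <= eta ->
  F y <= F z + dot (grad F z) (y - z)
         + (L0 + Num.sqrt rho * L1 * enorm (grad F z)) / 2
           * enorm (y - z) ^+ 2.
Proof.
move=> yz; set q := enorm (y - z) ^+ 2.
have id := integrable_dot_gradf z (y - z).
have ie := square_integrable_integrable (square_integrable_enorm_gradf z).
have ifd := integrableRD (f_integrable z) id.
have iq : D.-integrable setT
    (EFin \o (fun xi => q / 2 * L0 + q / 2 * L1 * enorm (gradf z xi))).
  by apply: integrableRD; [exact: integrable_cstR|exact: integrableRZ].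
apply: (@le_trans _ _ (\int[D]_xi
  ((f z xi + dot (gradf z xi) (y - z)) +
   (q / 2 * L0 + q / 2 * L1 * enorm (gradf z xi))))).
  rewrite -Rintegral_objective; apply: ae_le_Rintegral => //.
    exact: integrableRD.
  apply: filterS f_smooth => xi /(_ y y z (eta_radius yz))[_] hsm.
  by apply: le_trans hsm _; rewrite -/q lerD2l le_eqVlt; apply/orP; left;
    apply/eqP; ring.
rewrite !RintegralD//; try exact: integrable_cstR; try exact: integrableRZ.
rewrite Rintegral_objective Rintegral_dot_gradf lerD2l.
rewrite Rintegral_cst1 RintegralZl//.
have -> : (L0 + Num.sqrt rho * L1 * enorm (grad F z)) / 2 * q =
  q / 2 * L0 + q / 2 * L1 * (Num.sqrt rho * enorm (grad F z)) by ring.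
rewrite lerD2l ler_wpM2l ?Rintegral_enorm_gradf_le//.
by rewrite mulr_ge0// divr_ge0// sqr_ge0.
Qed.

Variables (lambda : R) (xstar : 'rV[R]_d).
Hypotheses (lambda_gt0 : 0 < lambda) (xstar_min : forall x, F xstar <= F x)
  (eta_L0 : eta * L0 <= lambda) (eta_L1 : eta * L1 <= 1)
  (eta_rho : eta * (Num.sqrt rho * L1) <= 1).

Lemma objective_gap_ge_grad x :
  eta / 2 * (enorm (grad F x) ^+ 2 / (lambda + enorm (grad F x)))
  <= F x - F xstar.
Proof.
apply: (suboptimality_ge_grad lambda_gt0 eta_gt0 eta_L0 eta_rho) => // y.
exact: objective_smooth.
Qed.

(** Linear in the gap, so that the gradient norm at a random point is integrable
    as soon as the gap is. *)
Lemma enorm_grad_le_gap x :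
  enorm (grad F x) <= 2 / eta * (F x - F xstar) + lambda.
Proof.
have := objective_gap_ge_grad x; set g := enorm _ => h.
have g0 : 0 <= g by exact: enorm_ge0.
rewrite -lerBlDr -(ler_pM2l (_ : 0 < eta / 2)) ?divr_gt0//.
have -> : eta / 2 * (2 / eta * (F x - F xstar)) = F x - F xstar.
  by field; rewrite gt_eqF.
apply: le_trans h; rewrite ler_pM2l ?divr_gt0// ler_pdivlMr ?ltr_wpDr//.
by have := sqr_ge0 lambda; nra.
Qed.

Lemma grad_minimizer : enorm (grad F xstar) = 0.
Proof.
have := objective_gap_ge_grad xstar; rewrite subrr; set g := enorm _ => h.
have g0 : 0 <= g by exact: enorm_ge0.
apply: contrapT => /eqP gn0; have g_gt0 : 0 < g by rewrite lt0r gn0.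
move: h; rewrite leNgt => /negP; apply.
by rewrite mulr_gt0 ?divr_gt0 ?exprn_gt0// addr_gt0.
Qed.

(** Strong growth forces interpolation: at a minimizer of [F] almost every
    sample gradient vanishes, since its second moment does. *)
Lemma interpolation : {ae D, forall xi, enorm (gradf xstar xi) = 0}.
Proof.
have se := square_integrable_enorm_gradf xstar.
have : (\int[D]_xi `|(enorm (gradf xstar xi) ^+ 2)%:E| = 0)%E.
  apply/eqP; rewrite eq_le; apply/andP; split; last exact: integral_ge0.
  apply: le_trans (le_trans (enorm_gradf_second_moment xstar) _); last first.
    by rewrite grad_minimizer expr0n mulr0.
  rewrite le_eqVlt; apply/orP; left; apply/eqP.
  by apply: eq_integral => xi _; rewrite /= ger0_norm// sqr_ge0.
move/ae_eq_integral_abs => /(_ measurableT)/(_ _)/[dup] _ h.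
have {h} := h (measurable_int _ se.2).
apply: filterS => xi /(_ I)[] /eqP; rewrite sqrf_eq0 => /eqP.
by [].
Qed.

(** What is used of a typical sample: it is smooth and convex, and shares the
    minimizer of [F]; the latter makes its gradient point away from [xstar]. *)
Lemma sample_grad_correlation : {ae D, forall xi, forall x,
  eta / 2 * (enorm (gradf x xi) ^+ 2 / (lambda + enorm (gradf x xi)))
  <= dot (gradf x xi) (x - xstar)}.
Proof.
apply: filterS2 f_smooth interpolation => xi sm g0 x.
have xmin y : f xstar xi <= f y xi.
  have [|+ _] := sm xstar y y.
    by apply: eta_radius; rewrite subrr enorm0 ltW.
  by rewrite (enorm0_eq0 g0) dot0l addr0.
apply: (@le_trans _ _ (f x xi - f xstar xi)).
  apply: (suboptimality_ge_grad (h := f^~ xi) lambda_gt0 eta_gt0 eta_L0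
    eta_L1) => //.
  by move=> y yx; have [] := sm x y x (eta_radius yx).
have [|+ _] := sm x xstar xstar.
  by apply: eta_radius; rewrite subrr enorm0 ltW.
by rewrite -(opprB x xstar) dotNr; lra.
Qed.

End Regularity.

Section BatchError.
Context {dO : measure_display} {Omega : measurableType dO}
  {P : probability Omega R} {B : nat} (X : 'I_B -> {RV P >-> Xi}).
Hypotheses (B_gt0 : (0 < B)%N) (B_ge : 64 * (rho - 1) <= B%:R)
  (XD : forall i A, measurable A -> distribution P (X i) A = D A)
  (Xi_indep : forall i j, i != j -> indep_pair (X i) (X j)).

(** With at least [64 (rho - 1)] samples the variance of the batch gradient is
    at most [(|grad F x| / 8) ^ 2]. *)
Lemma batch_error_le (x : 'rV[R]_d) :
  (\int[P]_w (enorm (B%:R^-1 *: (\sum_i gradf x (X i w)) - grad F x))%:E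
   <= (enorm (grad F x) / 8)%:E)%E.
Proof.
set G := grad F x; pose err w := B%:R^-1 *: (\sum_i gradf x (X i w)) - G.
have merr : measurable_vec err.
  apply: measurable_vecB => [|j]; last exact: measurable_cst.
  apply: (@measurable_batch_mean _ _ _ _ f _ _ _ (fun=> x) X) => //.
  exact: measurable_objective.
apply: mean_le_of_second_moment.
- by rewrite divr_ge0// enorm_ge0.
- exact: measurable_enorm.
- by move=> w; exact: enorm_ge0.
have BV j := batch_variance B_gt0 XD Xi_indep (square_integrable_gradf x j)
  (Rintegral_gradf x j).
have errE w : enorm (err w) ^+ 2 =
    \sum_j (B%:R^-1 * (\sum_i gradf x (X i w) 0 j) - G 0 j) ^+ 2.
  by rewrite enorm_sum_sqr; apply: eq_bigr => j _; rewrite !mxE summxE.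
have ierr : P.-integrable setT (EFin \o (fun w => enorm (err w) ^+ 2)).
  by under eq_fun do rewrite errE; apply: integrableR_sum => j; exact: (BV j).1.
have -> : (\int[P]_w (enorm (err w) ^+ 2)%:E =
           (\int[P]_w (enorm (err w) ^+ 2))%:E)%E.
  rewrite /Rintegral fineK//; exact: (integrable_fin_num measurableT ierr).
rewrite lee_fin; under eq_Rintegral do rewrite errE.
rewrite Rintegral_sum; last by move=> j; exact: (BV j).1.
under eq_bigr => j _ do rewrite (BV j).2.
rewrite -mulr_sumr sumrB -enorm_sum_sqr -Rintegral_sum; last first.
  by move=> j; exact: (square_integrable_gradf x j).2.
under eq_Rintegral do rewrite -enorm_sum_sqr.
rewrite -/G; have := Rintegral_sqr_enorm_gradf_le x; rewrite -/G => hg.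
have BR0 : 0 < B%:R :> R by rewrite ltr0n.
rewrite -(ler_pM2l BR0) mulrA mulfV ?gt_eqF// mul1r.
have := ler_wpM2r (sqr_ge0 (enorm G)) B_ge; rewrite expr_div_n.
move: hg; move: (\int[D]_xi _) (enorm G ^+ 2) => a b; lra.
Qed.

End BatchError.

End Oracle.

(** * Convergence of the iterates *)

(** With [a = 1 - eta / (4 R0)], the additive error of one step is
    [(1 - a) * (6 lambda R0)], so that [6 lambda R0] is a fixed point of the
    recursion and [a >= 0] keeps the bound invariant. *)
Lemma descent_recursion (R : realFieldType) (e g : nat -> R)
    (eta lambda R0 : R) :
  0 <= lambda -> 0 < eta -> 0 <= R0 -> 0 <= 1 - eta / (4 * R0) -> 0 <= e 0%N ->
  (forall k, e k <= R0 * g k) ->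
  (forall k, e k.+1 <= e k - eta / 4 * g k + 3 / 2 * eta * lambda) ->
  forall k, e k <= (1 - eta / (4 * R0)) ^+ k * e 0%N + 6 * lambda * R0.
Proof.
move=> lam0 eta0; rewrite le_eqVlt => /predU1P[<- _ e0 he _ k|R0_gt0 a0 e0 he hs].
  (* For [R0 = 0] the factor is [1], as [eta / 0 = 0], and every [e k <= 0]. *)
  by rewrite (le_trans (he k))// mulr0 invr0 mulr0 subr0 expr1n mul0r mulr0; lra.
elim=> [|k IH]; first by rewrite expr0 mul1r lerDl !mulr_ge0// ltW.
apply: le_trans (hs k) _.
have gk : e k / R0 <= g k by rewrite ler_pdivrMr// mulrC.
set a := 1 - _ in a0 IH *.
have aE : eta / 4 * (e k / R0) = (1 - a) * e k by rewrite /a; field; lra.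
have bE : 3 / 2 * eta * lambda = (1 - a) * (6 * lambda * R0).
  by rewrite /a; field; lra.
have := ler_wpM2l a0 IH; rewrite mulrDr mulrA -exprS.
have : eta / 4 * (e k / R0) <= eta / 4 * g k.
  by rewrite ler_pM2l// divr_gt0.
rewrite aE bE; lra.
Qed.

(** The gap after the step is integrable because the
    gradient norm is controlled by the gap before it, and the gradient error by
    the gradient norm. *)
Lemma expected_descent (R : realType) (dO : measure_display)
    (Omega : measurableType dO) (P : probability Omega R)
    (u u' c err : Omega -> R) (eta lambda : R) :
  0 < lambda -> 0 < eta ->
  measurable_fun setT u' -> measurable_fun setT c -> measurable_fun setT err ->
  (forall w, 0 <= u' w) -> (forall w, 0 <= c w) -> (forall w, 0 <= err w) ->
  P.-integrable setT (EFin \o u) ->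
  (forall w, c w <= 2 / eta * u w + lambda) ->
  (forall w, u' w + eta / 2 * c w <=
             u w + (3 / 2 * eta * lambda + 2 * eta * err w)) ->
  (\int[P]_w (err w)%:E <= \int[P]_w (c w / 8)%:E)%E ->
  [/\ P.-integrable setT (EFin \o c), P.-integrable setT (EFin \o u') &
   \int[P]_w u' w <=
   \int[P]_w u w - eta / 4 * (\int[P]_w c w) + 3 / 2 * eta * lambda].
Proof.
move=> lam0 eta0 mu' mc me u'0 c0 e0 iu cu hs he.
have ic : P.-integrable setT (EFin \o c).
  apply: (@le_integrable _ _ _ _ _ measurableT _
    (EFin \o (fun w => 2 / eta * u w + lambda))) => //.
  - exact/measurable_EFinP.
  - move=> w _ /=; rewrite lee_fin ger0_norm//.
    exact: le_trans (cu w) (ler_norm _).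
  - by apply: integrableRD; [exact: integrableRZ|exact: integrable_cstR].
have ic8 : P.-integrable setT (EFin \o (fun w => 8^-1 * c w)).
  exact: integrableRZ.
have ie : P.-integrable setT (EFin \o err).
  apply/integrableP; split; first exact/measurable_EFinP.
  rewrite (_ : (\int[P]_w _)%E = (\int[P]_w (err w)%:E)%E); last first.
    by apply: eq_integral => w _ /=; rewrite ger0_norm.
  apply: le_lt_trans he _; rewrite (_ : (\int[P]_w _)%E =
     (\int[P]_w (EFin \o (fun w => 8^-1 * c w)%R) w)%E).
    by rewrite ltey_eq (integrable_fin_num measurableT ic8).
  by apply: eq_integral => w _ /=; rewrite mulrC.
have ieh : P.-integrable setT
    (EFin \o (fun w => 3 / 2 * eta * lambda + 2 * eta * err w)).
  by apply: integrableRD; [exact: integrable_cstR|exact: integrableRZ].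
have iu' : P.-integrable setT (EFin \o u').
  apply: (@le_integrable _ _ _ _ _ measurableT _
    (EFin \o (fun w => u w + (3 / 2 * eta * lambda + 2 * eta * err w)))) => //.
  - exact/measurable_EFinP.
  - move=> w _ /=; rewrite lee_fin ger0_norm//.
    apply: le_trans (ler_norm _); apply: le_trans (hs w).
    by rewrite lerDl mulr_ge0// divr_ge0// ltW.
  - exact: integrableRD.
split=> //.
have hI : \int[P]_w (u' w + eta / 2 * c w) <=
          \int[P]_w (u w + (3 / 2 * eta * lambda + 2 * eta * err w)).
  apply: le_Rintegral => //; last exact: integrableRD.
  by apply: integrableRD => //; exact: integrableRZ.
have heI : \int[P]_w err w <= 8^-1 * \int[P]_w c w.
  rewrite -RintegralZl//; apply: fine_le.
  - exact: (integrable_fin_num measurableT ie).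
  - exact: (integrable_fin_num measurableT ic8).
  - apply: le_trans he _; rewrite le_eqVlt; apply/orP; left; apply/eqP.
    by apply: eq_integral => w _ /=; rewrite mulrC.
move: hI; rewrite !RintegralD//; try exact: integrable_cstR;
  try exact: integrableRZ.
rewrite Rintegral_cst1 !RintegralZl//.
have := ler_wpM2l (ltW eta0) heI; lra.
Qed.
Section Trajectory.
Context {R : realType} {d : nat} {dX : measure_display} {Xi : measurableType dX}
  {D : probability Xi R} {f : 'rV[R]_d -> Xi -> R} {F : 'rV[R]_d -> R}.
Hypotheses
  (f_integrable : forall x, D.-integrable setT (EFin \o f x))
  (F_expectation : forall x, (F x)%:E = ('E_D[f x])%E)
  (f_differentiable : forall xi x, differentiable (f^~ xi) x)
  (F_differentiable : forall x, differentiable F x).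
Variables (xstar : 'rV[R]_d) (L0 L1 : R).
Hypotheses (xstar_min : forall x, F xstar <= F x)
  (L0_ge0 : 0 <= L0) (L1_ge0 : 0 <= L1)
  (f_smooth : {ae D, forall xi, smooth_convex L0 L1 (f^~ xi)})
  (unbiased : forall x (j : 'I_d),
      ('E_D[fun xi => (grad (f^~ xi) x 0 j)%R])%E = (grad F x 0 j)%:E).
Variables (rho lambda eta : R).
Hypotheses (rho_ge1 : 1 <= rho)
  (strong_growth : forall x,
      ('E_D[fun xi => (enorm (grad (f^~ xi) x) ^+ 2)%R]
       <= (rho * enorm (grad F x) ^+ 2)%:E)%E)
  (lambda_gt0 : 0 < lambda) (eta_gt0 : 0 < eta)
  (eta_le : (eta%:E <= lambda%:E / (L0 + Num.sqrt rho * L1 * lambda)%:E)%E).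
Context {B : nat} {dO : measure_display} {Omega : measurableType dO}
  {P : probability Omega R} {xi : nat -> 'I_B -> {RV P >-> Xi}}.
Hypotheses (B_ge1 : (1 <= B)%N) (B_ge : 64 * (rho - 1) <= B%:R)
  (xi_iid : iid D (fun ki : nat * 'I_B => xi ki.1 ki.2)).
Variable x0 : 'rV[R]_d.

Let x k w := nsgd f eta lambda x0 (fun k i => xi k i w) k.
Let g k w := B%:R^-1 *: \sum_(i < B) grad (f^~ (xi k i w)) (x k w).

Let radius r : r <= eta -> (r%:E <= (L1%:E)^-1)%E.
Proof.
exact: (step_size_radius L0_ge0 L1_ge0 rho_ge1 lambda_gt0 eta_gt0 eta_le).
Qed.

Let eta_L0 : eta * L0 <= lambda :=
  step_size_L0 L0_ge0 L1_ge0 lambda_gt0 eta_gt0 eta_le.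

Let eta_L1 : eta * L1 <= 1 :=
  step_size_L1 L0_ge0 L1_ge0 rho_ge1 lambda_gt0 eta_gt0 eta_le.

Let eta_rho : eta * (Num.sqrt rho * L1) <= 1 :=
  step_size_sqrt_rho_L1 L0_ge0 L1_ge0 lambda_gt0 eta_gt0 eta_le.

Let xi_law k i A : measurable A -> distribution P (xi k i) A = D A.
Proof. by move=> mA; exact: (xi_iid.2 (k, i)). Qed.

Let measurable_f := measurable_objective f_integrable.

Lemma measurable_iterate k : measurable_vec (x k).
Proof.
by apply: (@measurable_nsgd _ _ _ _ f _ _ _ _ _ _ (fun j i w => xi j i w)).
Qed.

Lemma measurable_gap k : measurable_fun setT (fun w => F (x k w) - F xstar).
Proof.
apply: measurable_funB => //.
apply: (measurable_caratheodory (h := fun y _ => F y)) => //.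
- by move=> _ y; exact/differentiable_continuous.
- exact: measurable_iterate.
Qed.

Lemma measurable_grad_objective (dT : measure_display) (T : measurableType dT)
    (X : T -> 'rV[R]_d) :
  measurable_vec X -> measurable_vec (fun t => grad F (X t)).
Proof. exact: (measurable_grad (h := fun y _ => F y)). Qed.

Lemma measurable_step_grad k : measurable_vec (g k).
Proof.
by apply: measurable_batch_mean => //; exact: measurable_iterate.
Qed.

Lemma measurable_step_error k :
  measurable_fun setT (fun w => enorm (g k w - grad F (x k w))).
Proof.
apply/measurable_enorm/measurable_vecB; first exact: measurable_step_grad.
exact/measurable_grad_objective/measurable_iterate.
Qed.

(** The iterate [x k] is a function of the batches before [k]; freezing it
    reduces the error of batch [k] to the one at a fixed point. *)
Lemma step_error_le k :
  (\int[P]_w (enorm (g k w - grad F (x k w)))%:E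
   <= \int[P]_w (enorm (grad F (x k w)) / 8)%:E)%E.
Proof.
pose X (ki : nat * 'I_B) := xi ki.1 ki.2.
pose past := [seq (j, i) | j <- iota 0 k, i <- enum 'I_B].
pose batch := [seq (k, i) | i <- enum 'I_B].
have past_mem j i : (j < k)%N -> (j, i) \in past.
  by move=> jk; apply/allpairsP; exists (j, i); rewrite /= mem_iota mem_enum.
have batch_mem i : (k, i) \in batch by apply: map_f; rewrite mem_enum.
have u : uniq (past ++ batch).
  rewrite cat_uniq; apply/and3P; split.
  - apply: allpairs_uniq => [||[? ?] [? ?] _ _ //]; first exact: iota_uniq.
    exact: enum_uniq.
  - apply/hasPn => _ /mapP[i _ ->]; apply/negP => /allpairsP[[j i'] /= [jk _]].
    move: jk; rewrite mem_iota add0n => /andP[_ jk] [kj _].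
    by rewrite kj ltnn in jk.
  - by rewrite map_inj_uniq ?enum_uniq// => i j [].
pose phi (z : observed X past * observed X batch) : \bar R :=
  (enorm (B%:R^-1 *: (\sum_i grad (f^~ (xi k i z.2)) (x k z.1))
          - grad F (x k z.1)))%:E.
have mx : measurable_vec
    (fun z : observed X past * observed X batch => x k z.1).
  apply: (@measurable_nsgd _ _ _ _ f _ _ _ _ _ _
    (fun j i (z : observed X past * observed X batch) => xi j i z.1)) => // j i jk.
  by apply: (measurableT_comp (measurable_observed (X := X) (past_mem j i jk))).
apply: (freezing (X := X) xi_iid.1 (phi := phi) u).
- apply/measurable_EFinP/measurable_enorm/measurable_vecB; last first.
    exact: measurable_grad_objective.
  apply: (@measurable_batch_mean _ _ _ _ f _ _ _ _
    (fun i (z : observed X past * observed X batch) => xi k i z.2)) => // i.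
  by apply: (measurableT_comp (measurable_observed (X := X) (batch_mem i))).
- by move=> z; rewrite lee_fin enorm_ge0.
- apply/measurable_EFinP; apply: measurable_funM => //.
  apply: measurable_enorm; apply: measurable_grad_objective.
  exact: measurable_iterate.
have xi_indep i j : i != j -> indep_pair (xi k i) (xi k j).
  move=> ij; have kij : (k, i) != (k, j) by rewrite xpair_eqE eqxx.
  exact: (mutually_indep_pair (X := X) xi_iid.1 kij).
move=> w.
have h := batch_error_le f_integrable f_differentiable unbiased
  strong_growth B_ge1 B_ge (xi_law k) xi_indep (x k w).
exact: h.
Qed.

Lemma step_descent k w :
  F (x k.+1 w) - F xstar + eta / 2 * enorm (grad F (x k w)) <=
  F (x k w) - F xstar +
  (3 / 2 * eta * lambda + 2 * eta * enorm (g k w - grad F (x k w))).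
Proof.
pose v := - ((eta / (enorm (g k w) + lambda)) *: g k w).
have n0 := enorm_ge0 (g k w).
have nl0 : 0 < enorm (g k w) + lambda by rewrite ltr_wpDl.
have vE : x k.+1 w - x k w = v by rewrite /= addrC addKr.
have vn : enorm v <= eta.
  rewrite enormN enormZ gtr0_norm ?divr_gt0//.
  by rewrite mulrAC ler_pdivrMr// ler_pM2l// lerDl ltW.
have := objective_smooth f_integrable F_expectation f_differentiable f_smooth
  unbiased strong_growth rho_ge1 L1_ge0 radius.
move=> /(_ (x k.+1 w) (x k w)); rewrite vE => /(_ vn) sm.
have := @normalized_step_descent _ _ L0 (Num.sqrt rho * L1) eta lambda
  (grad F (x k w)) (g k w) v L0_ge0 _ lambda_gt0 eta_gt0 _ erefl.
have r0 : 0 <= Num.sqrt rho * L1 by rewrite mulr_ge0// sqrtr_ge0.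
move=> /(_ r0 (step_size_le L0_ge0 L1_ge0 lambda_gt0 eta_le)); lra.
Qed.

(** Almost surely no step moves away from [xstar]: each gradient of the batch
    points away from it, and Jensen's inequality carries the quantitative form
    of this to their mean. *)
Lemma iterate_dist_le k :
  {ae P, forall w, enorm (x k w - xstar) <= enorm (x0 - xstar)}.
Proof.
have corr := sample_grad_correlation f_integrable F_expectation
  f_differentiable f_smooth unbiased strong_growth rho_ge1 L1_ge0 eta_gt0
  radius lambda_gt0 xstar_min eta_L0 eta_L1 eta_rho.
elim: k => [|k IH]; first exact: nearW.
have : {ae P, forall w, forall i : 'I_B, forall y,
    eta / 2 * (enorm (grad (f^~ (xi k i w)) y) ^+ 2 /
               (lambda + enorm (grad (f^~ (xi k i w)) y)))
    <= dot (grad (f^~ (xi k i w)) y) (y - xstar)}.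
  by apply: filter_forall => i; exact: (law_ae (xi_law k i) corr).
apply: filterS2 IH => w hx hg; apply: le_trans hx.
apply: normalized_step_contracts => //.
rewrite -/(x k w) -/(g k w) /g dotZl dot_suml.
apply: (@le_trans _ _ (B%:R^-1 * \sum_i (eta / 2 *
    (enorm (grad (f^~ (xi k i w)) (x k w)) ^+ 2 /
     (lambda + enorm (grad (f^~ (xi k i w)) (x k w)))))) ); last first.
  by rewrite ler_wpM2l ?invr_ge0 ?ler0n// ler_sum.
rewrite -mulr_sumr [leRHS]mulrCA ler_pM2l ?divr_gt0//.
apply: sqr_div_jensen => //; first exact: enorm_ge0.
  by move=> i; exact: enorm_ge0.
rewrite enormZ ger0_norm ?invr_ge0 ?ler0n// ler_wpM2l ?invr_ge0 ?ler0n//.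
exact: enorm_sum.
Qed.

(** Convexity, Cauchy-Schwarz and the monotone distance to [xstar]. *)
Lemma gap_le_grad k : {ae P, forall w,
  F (x k w) - F xstar <= enorm (x0 - xstar) * enorm (grad F (x k w))}.
Proof.
apply: filterS (iterate_dist_le k) => w hw.
have := objective_convex f_integrable F_expectation f_differentiable f_smooth
  unbiased strong_growth eta_gt0 radius (x k w) xstar.
rewrite -(opprB (x k w)) dotNr => cvx.
have := dot_le_enorm (grad F (x k w)) (x k w - xstar).
have := ler_wpM2l (enorm_ge0 (grad F (x k w))) hw.
by rewrite (mulrC (enorm (x0 - xstar))); lra.
Qed.

Lemma expected_step k :
  P.-integrable setT (EFin \o (fun w => F (x k w) - F xstar)) ->
  [/\ P.-integrable setT (EFin \o (fun w => enorm (grad F (x k w)))),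
   P.-integrable setT (EFin \o (fun w => F (x k.+1 w) - F xstar)) &
   \int[P]_w (F (x k.+1 w) - F xstar) <=
   \int[P]_w (F (x k w) - F xstar)
   - eta / 4 * (\int[P]_w enorm (grad F (x k w))) + 3 / 2 * eta * lambda].
Proof.
move=> iu.
apply: (expected_descent (u := fun w => F (x k w) - F xstar)
  (err := fun w => enorm (g k w - grad F (x k w))) lambda_gt0 eta_gt0) => //.
- exact: measurable_gap.
- exact/measurable_enorm/measurable_grad_objective/measurable_iterate.
- exact: measurable_step_error.
- by move=> w; rewrite subr_ge0.
- by move=> w; exact: enorm_ge0.
- by move=> w; exact: enorm_ge0.
- move=> w; exact: (enorm_grad_le_gap f_integrable F_expectation
    f_differentiable f_smooth unbiased strong_growth rho_ge1 L1_ge0 eta_gt0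
    radius lambda_gt0 xstar_min eta_L0 eta_rho).
- exact: step_descent.
- exact: step_error_le.
Qed.

Lemma integrable_gap k :
  P.-integrable setT (EFin \o (fun w => F (x k w) - F xstar)).
Proof.
elim: k => [|k /expected_step[_ iu _]]; last exact: iu.
exact: (integrable_cstR P (F x0 - F xstar)).
Qed.

Lemma expected_gap_le k : 0 <= 1 - eta / (4 * enorm (x0 - xstar)) ->
  \int[P]_w (F (x k w) - F xstar) <=
  (1 - eta / (4 * enorm (x0 - xstar))) ^+ k * (F x0 - F xstar)
  + 6 * lambda * enorm (x0 - xstar).
Proof.
move=> factor_ge0.
have e0 : \int[P]_w (F (x 0%N w) - F xstar) = F x0 - F xstar.
  exact: (Rintegral_cst1 P (F x0 - F xstar)).
rewrite -e0; apply: (@descent_recursion _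
  (fun j => \int[P]_w (F (x j w) - F xstar))
  (fun j => \int[P]_w enorm (grad F (x j w)))) => //.
- exact: ltW.
- exact: enorm_ge0.
- by rewrite e0 subr_ge0.
- move=> j; have [ic _ _] := expected_step (integrable_gap j).
  rewrite -RintegralZl//; apply: ae_le_Rintegral (gap_le_grad j).
    exact: integrable_gap.
  exact: integrableRZ.
- by move=> j; have [_ _] := expected_step (integrable_gap j).
Qed.

End Trajectory.

Theorem theorem4p7 (R : realType) (d : nat)
    (dX : measure_display) (Xi : measurableType dX) (D : probability Xi R)
    (f : 'rV[R]_d -> Xi -> R) (F : 'rV[R]_d -> R)
    (f_integrable : forall x, D.-integrable setT (EFin \o f x))
    (F_expectation : forall x, (F x)%:E = ('E_D[f x])%E)
    (f_differentiable : forall xi x, differentiable (f^~ xi) x)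
    (F_differentiable : forall x, differentiable F x)
    (xstar : 'rV[R]_d) (xstar_min : forall x, F xstar <= F x)
    (L0 L1 : R) (L0_ge0 : 0 <= L0) (L1_ge0 : 0 <= L1)
    (f_smooth : {ae D, forall xi, smooth_convex L0 L1 (f^~ xi)})
    (unbiased : forall x (j : 'I_d),
      ('E_D[fun xi => (grad (f^~ xi) x 0 j)%R])%E = (grad F x 0 j)%:E)
    (rho : R) (rho_ge1 : 1 <= rho)
    (strong_growth : forall x,
      ('E_D[fun xi => (enorm (grad (f^~ xi) x) ^+ 2)%R]
       <= (rho * enorm (grad F x) ^+ 2)%:E)%E)
    (lambda : R) (lambda_gt0 : 0 < lambda)
    (eta : R) (eta_gt0 : 0 < eta)
    (* division in \bar R, with value +oo if L0 = L1 = 0 *)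
    (eta_le : (eta%:E
               <= lambda%:E / (L0 + Num.sqrt rho * L1 * lambda)%:E)%E)
    (B : nat) (B_ge1 : (1 <= B)%N) (B_ge : 64 * (rho - 1) <= B%:R)
    (dO : measure_display) (Omega : measurableType dO)
    (P : probability Omega R) (xi : nat -> 'I_B -> {RV P >-> Xi})
    (xi_iid : iid D (fun ki : nat * 'I_B => xi ki.1 ki.2))
    (x0 : 'rV[R]_d) (N : nat)
    (* For a negative factor and N odd the bound can fail: d = 1,
       f x xi = x ^ 2 / 2, eta = lambda = 10, x0 = 1/10, N = 3.  For x0 = xstar
       the convention y / 0 = 0 makes this hypothesis trivial. *)
    (factor_ge0 : 0 <= 1 - eta / (4 * enorm (x0 - xstar))) :
  let F0 := F x0 - F xstar in
  let R0 := enorm (x0 - xstar) in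
  let x k w := nsgd f eta lambda x0 (fun k i => xi k i w) k in
  ('E_P[fun w => F (x N w)] - (F xstar)%:E
   <= ((1 - eta / (4 * R0)) ^+ N * F0 + 6 * lambda * R0)%:E)%E.
Proof.
cbv zeta; pose x k w := nsgd f eta lambda x0 (fun k i => xi k i w) k.
have iu := integrable_gap f_integrable F_expectation f_differentiable
  F_differentiable xstar_min L0_ge0 L1_ge0 f_smooth unbiased rho_ge1
  strong_growth lambda_gt0 eta_gt0 eta_le B_ge1 B_ge xi_iid x0 N.
have := expected_gap_le f_integrable F_expectation f_differentiable
  F_differentiable xstar_min L0_ge0 L1_ge0 f_smooth unbiased rho_ge1
  strong_growth lambda_gt0 eta_gt0 eta_le B_ge1 B_ge xi_iid N factor_ge0.
rewrite -lee_fin fineK; last exact: (integrable_fin_num measurableT iu).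
apply: le_trans; rewrite unlock.
have -> : (\int[P]_w (F (x N w))%:E =
    \int[P]_w ((F (x N w) - F xstar)%:E + (F xstar)%:E))%E.
  by apply: eq_integral => w _; rewrite -EFinD subrK.
rewrite integralD_EFin//; last exact: integrable_cstR.
have P1 : (P : {measure set Omega -> \bar R}) setT = 1%E.
  exact: probability_setT.
by rewrite integral_cst// P1 mule1 addeK.
Qed.
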